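(* Let $\varphi$ be a satisfiable LTL formula over the variables in $\mathcal{I}\cup\mathcal{O}$. Then the algorithm $\mathcal{NDC}$ described in the context, run on input $\varphi$ (whatever the choices of variables made by the algorithm and whatever falsifying traces are returned by the validity checker), returns a partition of $\mathcal{O}$ into minimal independent sets; that is, the returned sets are pairwise disjoint with union $\mathcal{O}$, each is independent in $\varphi$, and none of them has a non-empty proper subset that is independent in $\varphi$.
   Context: Propositional variables are split into two disjoint sets: $\mathcal{I}$ (controlled by the environment) and the finite set $\mathcal{O}$ (controlled by the system). $\mathcal{O}'=\{y'\mid y\in\mathcal{O}\}$ is a set of fresh primed copies of the variables in $\mathcal{O}$. LTL formulae are built from variables with $\neg,\wedge$, $\bigcirc$ (next), $\mathcal{U}$ (until) and the usual abbreviations $\mathbf{F}$ (the constant false), $\vee,\to,\leftrightarrow$, $\Diamond$ (eventually), $\Box$ (always). They are interpreted with the standard semantics, evaluated at position $0$, over traces, i.e. infinite sequences $\sigma=\sigma_0,\sigma_1,\dots$ of sets of variables ($\sigma_i$ is the set of variables true at time $i$). A formula is valid if all traces (over the variables $\mathcal{I}\cup\mathcal{O}\cup\mathcal{O}'$) satisfy it. For $V\subseteq\mathcal{O}$ put $\overline V=\mathcal{O}\setminus V$. The projection formula $\varphi_V$ is obtained from $\varphi$ by replacing every variable $w\in\overline V$ by its primed copy $w'$ (variables in $\mathcal{I}\cup V$ are unchanged). Independence: $V\subseteq\mathcal{O}$ is independent in $\varphi$ iff the formula $(\varphi_V\wedge\varphi_{\overline V})\to\varphi$ is valid. CheckValidity$(\Phi)$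 returns $(\mathit{true},\cdot)$ if the LTL formula $\Phi$ is valid, and otherwise returns $(\mathit{false},\sigma)$, where $\sigma$ is some (arbitrary) trace over $\mathcal{I}\cup\mathcal{O}\cup\mathcal{O}'$ with $\sigma\not\models\Phi$. Algorithm $\mathcal{NDC}$ (input: a satisfiable LTL formula $\varphi$ over $\mathcal{I}\cup\mathcal{O}$; output: $\mathit{clusters}$): - Set $\mathit{clusters}:=\emptyset$, $R:=\mathcal{O}$. - Main loop: while $R\neq\emptyset$: choose any $x\in R$; set $V:=\{x\}$; repeat the following inner loop until $\mathit{passed}$ is true: [$\overline V:=\mathcal{O}\setminus V$; $(\mathit{passed},\sigma):=$ CheckValidity$((\varphi_V\wedge\varphi_{\overline V})\to\varphi)$; if not $\mathit{passed}$, then $D:=$ NewParseTrace$(\varphi,V,\sigma)$ and $V:=V\cup D$]. Then set $\mathit{clusters}:=\mathit{clusters}\cup\{V\}$ and $R:=\mathcal{O}\setminus\bigcup_{S\in\mathit{clusters}}S$. - Return $\mathit{clusters}$. NewParseTrace$(\varphi,V,\sigma)$, where $\sigma\models\varphi_V\wedge\varphi_{\overline V}\wedge\neg\varphi$: - Set $\mathit{passed}:=\mathit{false}$, $\mathit{binds}:=\mathbf{F}$, $\tau:=\sigma$. - While not $\mathit{passed}$: let $Z:=\{z\in\overline V : \text{for some } i\ge 0,\ (z\in\tau_i \text{ iff } z'\notin\tau_i)\}$; let $z$ be any variable in $Z$; set $\mathit{binds}:=\mathit{binds}\vee\Diamond(z\leftrightarrow\neg z')$; set $(\mathit{passed},\tau):=$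 CheckValidity$(\mathit{binds}\vee((\varphi_V\wedge\varphi_{\overline V})\to\varphi))$. - Return $\{z\}$ (the last variable chosen). *)

(* Defs.v *)
From mathcomp Require Import classical_sets.
From mathcomp Require Import all_boot.

Set Implicit Arguments.
Unset Strict Implicit.
Unset Printing Implicit Defensive.

(* The constant false is primitive, so that it exists even when the set [X] of
   variables is empty. *)
Inductive ltl (X : Type) : Type :=
| LVar of X
| LFalse
| LNot of ltl X
| LAnd of ltl X & ltl X
| LNext of ltl X
| LUntil of ltl X & ltl X.

Arguments LFalse {X}.

Definition LOr (X : Type) (f g : ltl X) : ltl X := LNot (LAnd (LNot f) (LNot g)).
Definition LImp (X : Type) (f g : ltl X) : ltl X := LOr (LNot f) g.
Definition LIff (X : Type) (f g : ltl X) : ltl X := LAnd (LImp f g) (LImp g f).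
Definition LEventually (X : Type) (f : ltl X) : ltl X := LUntil (LNot LFalse) f.

Definition trace (X : Type) : Type := nat -> set X.

Fixpoint sat_at (X : Type) (s : trace X) (i : nat) (f : ltl X) : Prop :=
  match f with
  | LVar v => s i v
  | LFalse => False
  | LNot g => ~ sat_at s i g
  | LAnd g h => sat_at s i g /\ sat_at s i h
  | LNext g => sat_at s i.+1 g
  | LUntil g h => exists k : nat,
      [/\ i <= k, sat_at s k h & forall j : nat, i <= j < k -> sat_at s j g]
  end.

Definition sat (X : Type) (s : trace X) (f : ltl X) : Prop := sat_at s 0 f.

Definition satisfiable (X : Type) (f : ltl X) : Prop := exists s : trace X, sat s f.
Definition valid (X : Type) (f : ltl X) : Prop := forall s : trace X, sat s f.

Fixpoint rename (X Y : Type) (r : X -> Y) (f : ltl X) : ltl Y :=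
  match f with
  | LVar v => LVar (r v)
  | LFalse => LFalse
  | LNot g => LNot (rename r g)
  | LAnd g h => LAnd (rename r g) (rename r h)
  | LNext g => LNext (rename r g)
  | LUntil g h => LUntil (rename r g) (rename r h)
  end.

(* Variables in the disjoint union of I, O and O', where O' is a copy of O.
   Formulae over the union of I and O only have type [ltl (I + O)]. *)
Inductive var (I O : Type) : Type :=
| Env of I
| Sys of O
| Primed of O.

Arguments Env {I O}.
Arguments Sys {I O}.
Arguments Primed {I O}.

Definition unprimed (I O : Type) (phi : ltl (I + O)) : ltl (var I O) :=
  rename (fun v => match v with inl x => Env x | inr y => Sys y end) phi.

Definition proj (I : Type) (O : finType) (V : {set O}) (phi : ltl (I + O)) :
    ltl (var I O) :=
  rename (fun v => match v with
                   | inl x => Env x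
                   | inr y => if y \in V then Sys y else Primed y
                   end) phi.

Definition indep_formula (I : Type) (O : finType) (phi : ltl (I + O))
    (V : {set O}) : ltl (var I O) :=
  LImp (LAnd (proj V phi) (proj (~: V) phi)) (unprimed phi).

Definition independent (I : Type) (O : finType) (phi : ltl (I + O))
    (V : {set O}) : Prop :=
  valid (indep_formula phi V).

(* The possible answers of the validity checker: [None] stands for the answer
   (true, _) and [Some s] for the answer (false, s). *)
Variant check_validity (X : Type) (f : ltl X) : option (trace X) -> Prop :=
| CheckTrue : valid f -> check_validity f None
| CheckFalse (s : trace X) : ~ sat s f -> check_validity f (Some s).

Definition candidate (I : Type) (O : finType) (V : {set O})
    (tau : trace (var I O)) (z : O) : Prop :=
  z \in ~: V /\ exists i : nat, (tau i (Sys z) <-> ~ tau i (Primed z)).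

Definition add_bind (I O : Type) (binds : ltl (var I O)) (z : O) :
    ltl (var I O) :=
  LOr binds (LEventually (LIff (LVar (Sys z)) (LNot (LVar (Primed z))))).

(* Control points of the algorithm, with the live program variables:
   - [Main]: the test of the main loop;
   - [Inner]: the beginning of the body of the inner loop;
   - [Parse]: the beginning of the body of the loop of NewParseTrace, called
     from the inner loop;
   - [Return]: the algorithm has returned. *)
Inductive state (I : Type) (O : finType) : Type :=
| Main (clusters : {set {set O}}) (R : {set O})
| Inner (clusters : {set {set O}}) (V : {set O})
| Parse (clusters : {set {set O}}) (V : {set O})
        (binds : ltl (var I O)) (tau : trace (var I O))
| Return (clusters : {set {set O}}).

Arguments Main {I O}.
Arguments Inner {I O}.
Arguments Return {I O}.

Inductive step (I : Type) (O : finType) (phi : ltl (I + O)) :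
    state I O -> state I O -> Prop :=
| MainExit clusters :
    step phi (Main clusters set0) (Return clusters)
| MainEnter clusters (R : {set O}) (x : O) :
    x \in R ->
    step phi (Main clusters R) (Inner clusters [set x])
| InnerPassed clusters (V : {set O}) :
    check_validity (indep_formula phi V) None ->
    step phi (Inner clusters V) (Main (V |: clusters) (~: cover (V |: clusters)))
| InnerFailed clusters (V : {set O}) (sigma : trace (var I O)) :
    check_validity (indep_formula phi V) (Some sigma) ->
    step phi (Inner clusters V) (Parse clusters V LFalse sigma)
(* NewParseTrace returns D = {z}, which the inner loop adds to V *)
| ParsePassed clusters (V : {set O}) binds (tau : trace (var I O)) (z : O) :
    candidate V tau z ->
    check_validity (LOr (add_bind binds z) (indep_formula phi V)) None ->
    step phi (Parse clusters V binds tau) (Inner clusters (V :|: [set z]))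
| ParseFailed clusters (V : {set O}) binds (tau tau' : trace (var I O)) (z : O) :
    candidate V tau z ->
    check_validity (LOr (add_bind binds z) (indep_formula phi V)) (Some tau') ->
    step phi (Parse clusters V binds tau) (Parse clusters V (add_bind binds z) tau').

Definition ndc_start (I : Type) (O : finType) : state I O := Main set0 [set: O].

(* Total correctness, for all resolutions of the nondeterminism: every execution
   from the given state is finite, never gets stuck (for instance by having no
   variable to choose), and returns clusters that satisfy [Q].  Being inductive,
   the predicate excludes infinite executions. *)
Inductive always_returns (I : Type) (O : finType) (phi : ltl (I + O))
    (Q : {set {set O}} -> Prop) : state I O -> Prop :=
| AlwaysReturn clusters :
    Q clusters -> always_returns phi Q (Return clusters)
| AlwaysStep (s : state I O) :
    (exists s', step phi s s') ->
    (forall s', step phi s s' -> always_returns phi Q s') ->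
    always_returns phi Q s.

(* Main.v *)
(** For a fixed environment behaviour, phi is a set L of assignments of traces
    to the system variables, and V is independent iff L is closed under the
    operation [mix V] that takes the variables of V from one element and the
    others from a second one.  Hence independent sets form a Boolean algebra,
    and each x lies in a least one, which is an atom.

    The inner loop keeps V below every independent U that contains x.  Indeed
    let f, g be the unprimed and primed parts of the falsifying trace from which
    NewParseTrace draws its last variable z.  If z were outside U, then replacing
    g by f outside U would again falsify the independence of V, with f and g now
    agreeing on z and still agreeing on all earlier candidates; the validity
    check that ends NewParseTrace excludes this. *)
Require Import Defs.
From mathcomp Require Import boolp classical_sets.
From mathcomp Require Import all_boot.

Set Implicit Arguments.
Unset Strict Implicit.
Unset Printing Implicit Defensive.

(** * Semantics of renaming, disjunction and validity checking *)

Section Semantics.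
Variable X : Type.
Implicit Types (s : trace X) (f g : ltl X).

Lemma sat_rename (Y : Type) (r : Y -> X) s (f : ltl Y) :
  sat s (rename r f) <-> sat (fun i v => s i (r v)) f.
Proof.
rewrite /sat; move: 0; elim: f => //= [g IH|g IHg h IHh|g IHg h IHh] i.
- by rewrite IH.
- by rewrite IHg IHh.
- split=> -[k [ik hk gk]]; exists k.
  + by split=> // [|j /gk /IHg]; [exact/IHh|].
  + by split=> // [|j /gk /IHg]; [exact/IHh|].
Qed.

Lemma sat_or s f g : sat s (LOr f g) <-> sat s f \/ sat s g.
Proof.
rewrite /sat /=; split=> [nfg|[sf|sg] [nf ng]] //.
by have [sf|nf] := EM (sat s f); [left|right; apply: contrapT => ng; apply: nfg].
Qed.

Lemma check_validity_total f : exists r, check_validity f r.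
Proof.
have [vf|/existsNP[s ns]] := EM (valid f); first by exists None; constructor.
by exists (Some s); constructor.
Qed.

End Semantics.

(** * Independence as closure under mixing *)

Section Independence.
Variables (I : Type) (O : finType) (phi : ltl (I + O)).
Implicit Types (s tau : trace (var I O)) (p q : trace (I + O)).
Implicit Types (U V W B : {set O}) (x y z : O).

(** Inputs come from [p]; wherever [mix] is used, [p] and [q] have the same inputs. *)
Definition mix V p q : trace (I + O) := fun i v =>
  match v with
  | inl _ => p i v
  | inr y => if y \in V then p i v else q i v
  end.

Definition sys s : trace (I + O) := fun i v =>
  match v with inl e => s i (Env e) | inr y => s i (Sys y) end.

Definition primed s : trace (I + O) := fun i v =>
  match v with inl e => s i (Env e) | inr y => s i (Primed y) end.

Lemma trace_ext p q : (forall i v, p i v = q i v) -> p = q.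
Proof. by move=> pq; apply/funext => i; apply/funext => v. Qed.

Lemma sat_indep_formula s V :
  sat s (indep_formula phi V) <->
  (sat (mix V (sys s) (primed s)) phi -> sat (mix (~: V) (sys s) (primed s)) phi ->
   sat (sys s) phi).
Proof.
have sat_proj W : sat s (proj W phi) <-> sat (mix W (sys s) (primed s)) phi.
  rewrite sat_rename; set p := (X in sat X _); suff -> : p = mix W (sys s) (primed s) by [].
  by apply: trace_ext => i [e|y] //; rewrite /p /=; case: ifP.
have sat_unprimed : sat s (unprimed phi) <-> sat (sys s) phi.
  rewrite sat_rename; set p := (X in sat X _); suff -> : p = sys s by [].
  by apply: trace_ext => i [].
rewrite sat_or -sat_unprimed -!sat_proj; split=> [[n|//] sV sW|imp].
  by case: n.
have [sV|nV] := EM (sat s (proj V phi)); last by left; case.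
have [sW|nW] := EM (sat s (proj (~: V) phi)); last by left; case.
by right; apply: imp.
Qed.

Lemma independentP V :
  independent phi V <->
  forall p q, (forall i e, p i (inl e) = q i (inl e)) ->
    sat p phi -> sat q phi -> sat (mix V p q) phi.
Proof.
split=> [indV p q pq sp sq|mixV s].
  (* The two complementary mixes of [p] and [q] form the unprimed and primed parts, so that mixing
     these parts again gives back [p] and [q]. *)
  pose s : trace (var I O) := fun i v =>
    match v with
    | Env e => p i (inl e)
    | Sys y => mix V p q i (inr y)
    | Primed y => mix V q p i (inr y)
    end.
  have -> : mix V p q = sys s by apply: trace_ext => i [].
  apply: (sat_indep_formula s V).1 => //.
    suff -> : mix V (sys s) (primed s) = p by [].
    by apply: trace_ext => i [e|y] //=; case: (y \in V).
  suff -> : mix (~: V) (sys s) (primed s) = q by [].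
  by apply: trace_ext => i [e|y] //=; rewrite inE; case: (y \in V).
apply/sat_indep_formula => sV sW.
suff -> : sys s = mix V (mix V (sys s) (primed s)) (mix (~: V) (sys s) (primed s)).
  exact: mixV.
by apply: trace_ext => i [e|y] //=; rewrite inE; case: (y \in V).
Qed.

Lemma independentC V : independent phi V -> independent phi (~: V).
Proof.
move=> /independentP indV; apply/independentP => p q pq sp sq.
suff -> : mix (~: V) p q = mix V q p by apply: indV.
by apply: trace_ext => i [e|y] //=; rewrite inE; case: (y \in V).
Qed.

Lemma independentI V W :
  independent phi V -> independent phi W -> independent phi (V :&: W).
Proof.
move=> /independentP indV /independentP indW; apply/independentP => p q pq sp sq.
suff -> : mix (V :&: W) p q = mix V (mix W p q) q.
  by apply: indV => //; apply: indW.
by apply: trace_ext => i [e|y] //=; rewrite inE; case: (y \in V).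
Qed.

(** * Differing variables and falsifying traces *)

Definition differs s z := exists i, (s i (Sys z) <-> ~ s i (Primed z)).

Lemma not_differs s z : ~ differs s z <-> forall i, s i (Sys z) = s i (Primed z).
Proof.
split=> [nd i|eq_sz [i]]; last by rewrite eq_sz; case: (EM (s i (Primed z))); tauto.
apply/propext; apply: contrapT => ne; apply: nd; exists i.
by case: (EM (s i (Sys z))); case: (EM (s i (Primed z))); tauto.
Qed.

(** If the two copies agree outside [V], mixing along [V] returns the unprimed part itself. Hence
    NewParseTrace never lacks a variable to choose. *)
Lemma falsified_candidate V tau :
  ~ sat tau (indep_formula phi V) -> exists z, candidate V tau z.
Proof.
move=> nsat; apply: contrapT => noz; apply: nsat.
apply/sat_indep_formula => sV _.
suff -> : sys tau = mix V (sys tau) (primed tau) by [].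
apply: trace_ext => i [e|y] //=; case: ifPn => // yV.
apply: (not_differs tau y).1 => dy.
by apply: noz; exists y; split; rewrite ?inE.
Qed.

Definition binds_on (binds : ltl (var I O)) B :=
  forall s, sat s binds <-> exists2 z, z \in B & differs s z.

Lemma binds_on0 : binds_on LFalse set0.
Proof. by move=> s; split=> // -[z]; rewrite inE. Qed.

Lemma sat_eventually_differs s z :
  sat s (LEventually (LIff (LVar (Sys z)) (LNot (LVar (Primed z))))) <->
  differs s z.
Proof.
split=> [[k [_ /= sk _]]|[k sk]]; exists k.
  by case: (EM (s k (Sys z))); case: (EM (s k (Primed z))); tauto.
by split=> //=; tauto.
Qed.

Lemma binds_onU1 binds B z :
  binds_on binds B -> binds_on (add_bind binds z) (z |: B).
Proof.
move=> bB s; rewrite sat_or bB sat_eventually_differs; split.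
  move=> [[y yB dy]|dz]; first by exists y; rewrite // !inE yB orbT.
  by exists z; rewrite // !inE eqxx.
by move=> [y /setU1P[->|yB] dy]; [right|left; exists y].
Qed.

(** Here [B] holds the earlier candidates, and the last premise is what the passed validity check
    says about traces without differences on [z |: B]. *)
Lemma last_candidate_in B V U z tau :
    independent phi U -> V \subset U ->
    ~ sat tau (indep_formula phi V) -> (forall y, y \in B -> ~ differs tau y) ->
    (forall s, (forall y, y \in z |: B -> ~ differs s y) ->
       sat s (indep_formula phi V)) ->
  z \in U.
Proof.
move=> /independentP indU VU ntau agreeB checked; apply/negPn/negP => zU.
pose s : trace (var I O) := fun i v =>
  match v with
  | Primed y => if y \in U then tau i (Primed y) else tau i (Sys y)
  | _ => tau i v
  end.
apply: ntau; apply/sat_indep_formula => sV sVc.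
have -> : sys tau = sys s by apply: trace_ext => i [].
apply: (sat_indep_formula s V).1; first apply: checked => y.
- rewrite not_differs => /setU1P[->|yB] i /=; first by rewrite (negbTE zU).
  by case: ifP => // _; apply: (not_differs tau y).1; apply: agreeB.
(* Outside [U], hence outside [V], both sides take the unprimed value; on [U] the trace [s] is
   [tau]. *)
- suff -> : mix V (sys s) (primed s) =
    mix U (mix V (sys tau) (primed tau)) (mix (~: V) (sys tau) (primed tau)).
    exact: indU.
  apply: trace_ext => i [e|y] //=; rewrite inE.
  by case: (boolP (y \in V)) => [/(subsetP VU) ->|].
- suff -> : mix (~: V) (sys s) (primed s) = mix (~: V) (sys tau) (primed tau) by [].
  apply: trace_ext => i [e|y] //=; rewrite inE.
  by case: (boolP (y \in V)) => [/(subsetP VU) ->|].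
Qed.

(** The inner loop invariant; an independent such [V] is the least independent set containing
    [x]. *)
Definition below_atom x V :=
  x \in V /\ forall U, independent phi U -> x \in U -> V \subset U.

(** Either [U] or its complement contains [x]. If both were independent, the one containing [x]
    would include [S], making [U] improper or empty. *)
Lemma atom_minimal x S U :
  independent phi S -> below_atom x S -> U != set0 -> U \proper S ->
  ~ independent phi U.
Proof.
move=> indS [xS leS] U0 /properP[US [y yS yU]] indU.
have [xU|xU] := boolP (x \in U).
  by move/subsetP: (leS U indU xU) => /(_ y yS); rewrite (negbTE yU).
have /subsetP SsubC : S \subset ~: U.
  by apply: leS; [exact: independentC|rewrite inE].
have /set0Pn[z zU] := U0.
by have := SsubC z (subsetP US z zU); rewrite inE zU.
Qed.

Lemma atoms_disjoint x S T :
  independent phi S -> x \notin S -> below_atom x T -> [disjoint T & S].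
Proof.
move=> indS xS [_ leT]; rewrite disjoints_subset; apply: leT.
  exact: independentC.
by rewrite inE.
Qed.

(** * Termination and correctness of the three loops *)

Variable Q : {set {set O}} -> Prop.
Implicit Types clusters : {set {set O}}.

Lemma parse_returns clusters V x :
    below_atom x V ->
    (forall z, z \notin V -> below_atom x (V :|: [set z]) ->
       always_returns phi Q (Inner clusters (V :|: [set z]))) ->
  forall B binds tau, binds_on binds B -> ~ sat tau binds ->
    ~ sat tau (indep_formula phi V) ->
    always_returns phi Q (Parse clusters V binds tau).
Proof.
move=> [xV leV] inner B; have [n] := ubnP #|~: B|.
elim: n B => // n IH B ltn binds tau bB nbinds ntau.
apply: AlwaysStep.
  have [z zc] := falsified_candidate ntau.
  have [[tau'|] r] := check_validity_total (LOr (add_bind binds z) (indep_formula phi V)).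
    by exists (Parse clusters V (add_bind binds z) tau'); constructor.
  by exists (Inner clusters (V :|: [set z])); apply: ParsePassed r.
move=> s' st; inversion st as [| | | |? ? ? ? z zc r|? ? ? ? tau' z zc r]; subst.
  inversion r as [checked|]; case: zc; rewrite inE => zV dz.
  apply: inner => //; split=> [|U indU xU]; first by rewrite inE xV.
  rewrite subUset leV // sub1set.
  apply: (last_candidate_in indU (leV U indU xU) ntau (B := B)) => [y yB dy|s agree].
    by apply: nbinds; apply/bB; exists y.
  have /sat_or[/(binds_onU1 z bB)[y yB /(agree y yB)]|] // := checked s.
inversion r as [|? ntau']; subst; case: zc => _ dz.
(* Since [tau] falsifies [binds], each candidate is new, so the complement of [B] shrinks. *)
have zB : z \in ~: B by rewrite inE; apply/negP => zB; apply: nbinds; apply/bB; exists z.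
apply: (IH (z |: B)).
- by rewrite setCU setIC -setDE; move: ltn; rewrite (cardsD1 z) zB.
- exact: binds_onU1.
- by move=> h; apply: ntau'; apply/sat_or; left.
- by move=> h; apply: ntau'; apply/sat_or; right.
Qed.

Lemma inner_returns clusters x :
    (forall V, independent phi V -> below_atom x V ->
       always_returns phi Q (Main (V |: clusters) (~: cover (V |: clusters)))) ->
  forall V, below_atom x V -> always_returns phi Q (Inner clusters V).
Proof.
move=> main V; have [n] := ubnP #|~: V|; elim: n V => // n IH V ltn bV.
apply: AlwaysStep.
  have [[sigma|] r] := check_validity_total (indep_formula phi V).
    by exists (Parse clusters V LFalse sigma); constructor.
  by exists (Main (V |: clusters) (~: cover (V |: clusters))); constructor.
move=> s' st; inversion st as [| |? ? r|? ? sigma r| |]; subst.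
  by inversion r; apply: main.
inversion r as [|? nsigma]; subst.
apply: (parse_returns bV _ binds_on0) => // z zV bz; apply: IH => //.
by rewrite setCU -setDE; move: ltn; rewrite (cardsD1 z) inE zV.
Qed.

Definition atom_clusters clusters :=
  trivIset clusters /\
  forall S, S \in clusters -> independent phi S /\ exists x, below_atom x S.

Lemma main_returns clusters :
    (forall c, atom_clusters c -> ~: cover c = set0 -> Q c) ->
    atom_clusters clusters ->
  always_returns phi Q (Main clusters (~: cover clusters)).
Proof.
move=> ret; have [n] := ubnP #|~: cover clusters|.
elim: n clusters => // n IH clusters ltn atc.
apply: AlwaysStep.
  have [->|[x xR]] := set_0Vmem (~: cover clusters).
    by exists (Return clusters); constructor.
  by exists (Inner clusters [set x]); constructor 2.
move=> s' st; inversion st as [? R0|? ? x xR| | | |]; subst.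
  by apply/AlwaysReturn/ret.
have bx : below_atom x [set x] by split=> [|U _]; rewrite ?inE ?sub1set.
apply: inner_returns bx => V indV bV; move: xR; rewrite inE => xR.
have coverV : cover (V |: clusters) = V :|: cover clusters.
  by rewrite /cover bigcup_setU big_set1.
apply: IH.
  rewrite ltnS in ltn; apply: leq_trans ltn; apply: proper_card.
  rewrite coverV setCU; apply/properP; split; first exact: subsetIr.
  by exists x; rewrite !inE ?(negbTE xR) ?bV.1.
case: atc => triv atc; split; last by move=> S /setU1P[->|/atc] //; split=> //; exists x.
(* The chosen [x] is uncovered, so the independent complement of each old cluster contains [x] and
   hence [V]. *)
have disjV S : S \in clusters -> [disjoint V & S].
  move=> Sc; have [indS _] := atc S Sc; apply: atoms_disjoint indS _ bV.
  by apply: contra xR => xS; apply/bigcupP; exists S.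
apply/trivIsetP => S T /setU1P[->|Sc] /setU1P[->|Tc]; rewrite ?eqxx // => neST.
- exact: disjV.
- by rewrite disjoint_sym; apply: disjV.
- by move/trivIsetP: triv; apply.
Qed.

End Independence.

Theorem corollary2 (I : Type) (O : finType) (phi : ltl (I + O))
    (phi_sat : satisfiable phi) :
  always_returns phi
    (fun clusters : {set {set O}} =>
       [/\ partition clusters [set: O],
           forall S : {set O}, S \in clusters -> independent phi S
         & forall S U : {set O}, S \in clusters ->
             U != set0 -> U \proper S -> ~ independent phi U])
    (ndc_start I O).
Proof.
rewrite /ndc_start; have -> : [set: O] = ~: cover set0.
  by rewrite /cover big_set0 setC0.
apply: main_returns => [c [triv atc] coverc|]; last first.
  by split=> [|S]; [apply/trivIsetP => S T|]; rewrite inE.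
split=> [|S /atc[]|S U /atc[indS [x bx]]] //; last exact: atom_minimal bx.
apply/and3P; split=> //.
  by rewrite -[cover c]setCK coverc /cover big_set0.
(* Each cluster contains the variable it grew from, so none is empty. *)
by apply/negP => /atc[_ [x []]]; rewrite inE.
Qed.
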